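(* Let $p\in\{1,\infty\}$ and $\mathcal{X}=\{\boldsymbol{x}\in\mathbb{R}^n:\|\boldsymbol{x}\|_p\le1\}$, let $\kappa=\max_{\boldsymbol{x}\in\mathcal{X}}\|\boldsymbol{x}\|_2$ and $\mathcal{C}=\mathrm{cone}(\{\kappa\}\times\mathcal{X})\subset\mathbb{R}^{n+1}$. Then for every $\boldsymbol{u}\in\mathbb{R}^{n+1}$ the orthogonal projection $\pi_{\mathcal{C}}(\boldsymbol{u})$ can be computed in $O(n\log n)$ operations.
   Context: $\mathrm{cone}(\{\kappa\}\times\mathcal{X})=\{\alpha(\kappa,\boldsymbol{x}):\alpha\ge0,\boldsymbol{x}\in\mathcal{X}\}$; $\pi_{\mathcal{C}}$ denotes the Euclidean orthogonal projection onto $\mathcal{C}$. Operations are counted over the reals: each addition, subtraction, multiplication, division, comparison and root extraction counts as one operation. *)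

(* Defs.v *)
From mathcomp Require Export all_boot all_order all_algebra.
From mathcomp Require Export all_classical all_reals all_analysis.
Export Order.TTheory GRing.Theory Num.Theory numFieldNormedType.Exports.

#[export] Set Implicit Arguments.
#[export] Unset Strict Implicit.
#[export] Unset Printing Implicit Defensive.

Local Open Scope classical_set_scope.
Local Open Scope ring_scope.

(** Only [1 <= p <= +oo] is meaningful. *)
Definition lpnorm (R : realType) (p : \bar R) (n : nat) (x : 'rV[R]_n) : R :=
  match p with
  | r%:E => (\sum_(i < n) `|x 0 i| `^ r) `^ r^-1
  | +oo%E => \big[Num.max/0]_(i < n) `|x 0 i|
  | -oo%E => 0
  end.

Definition lpball (R : realType) (p : \bar R) (n : nat) : set 'rV[R]_n :=
  [set x | lpnorm p x <= 1].
Arguments lpball {R} p n _.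

(** The greatest element of [A]; a default value if there is none. *)
Definition maximum (R : realType) (A : set R) : R :=
  [get m | A m /\ ubound A m].

Definition cone (R : realType) (n : nat) (A : set 'rV[R]_n) : set 'rV[R]_n :=
  [set a *: v | a in [set a : R | 0 <= a] & v in A].

(** [{k} x A], as a subset of R^(n+1) whose coordinate 0 is [k]. *)
Definition lift_at (R : realType) (n : nat) (k : R) (A : set 'rV[R]_n) :
    set 'rV[R]_n.+1 :=
  [set (row_mx (k%:M : 'M[R]_1) x : 'rV[R]_(1 + n)) | x in A].

(** The point of [A] nearest to [u] in the Euclidean norm; it exists and is
    unique when [A] is nonempty, closed and convex. *)
Definition proj (R : realType) (n : nat) (A : set 'rV[R]_n) (u : 'rV[R]_n) :
    'rV[R]_n :=
  [get y | A y /\ forall z, A z -> lpnorm 2%:E (u - y) <= lpnorm 2%:E (u - z)].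

(** A real RAM.  A machine state has registers holding natural numbers, used
    for addressing and loop control only, and a memory of real cells with
    natural number addresses.  There is no transfer from reals to registers:
    real data can influence control only through [IfReal].  Programs are finite
    syntactic objects whose only real constants are integers, so a single
    program has to treat all dimensions. *)

Inductive iexp : Type :=
| ICst of nat
| IReg of nat
| IAdd of iexp & iexp
| ISub of iexp & iexp
| IMul of iexp & iexp
| IDiv of iexp & iexp.

Inductive rop : Type := RAdd | RSub | RMul | RDiv.

Inductive prog : Type :=
| Skip
| SetReg of nat & iexp                 (* reg[x] := e *)
| LoadCst of iexp & int                (* mem[d] := c *)
| Move of iexp & iexp                  (* mem[d] := mem[a] *)
| Arith of rop & iexp & iexp & iexp    (* mem[d] := mem[a] op mem[b] *)
| Sqrt of iexp & iexp                  (* mem[d] := sqrt mem[a] *)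
| Seq of prog & prog
| IfIdx of iexp & iexp & prog & prog   (* if a <= b, for indices *)
| IfReal of iexp & iexp & prog & prog  (* if mem[a] <= mem[b] *)
| While of iexp & iexp & prog.         (* while a < b, for indices *)

Record state (R : realType) : Type := State {
  reg : nat -> nat;
  mem : nat -> R
}.

Definition update (T : Type) (f : nat -> T) (k : nat) (v : T) : nat -> T :=
  fun i => if i == k then v else f i.

Definition set_reg (R : realType) (s : state R) (k v : nat) : state R :=
  State (update (reg s) k v) (mem s).

Definition set_mem (R : realType) (s : state R) (k : nat) (v : R) : state R :=
  State (reg s) (update (mem s) k v).

Fixpoint ieval (r : nat -> nat) (e : iexp) : nat :=
  match e with
  | ICst c => c
  | IReg x => r x
  | IAdd e1 e2 => (ieval r e1 + ieval r e2)%N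
  | ISub e1 e2 => (ieval r e1 - ieval r e2)%N
  | IMul e1 e2 => (ieval r e1 * ieval r e2)%N
  | IDiv e1 e2 => (ieval r e1 %/ ieval r e2)%N
  end.

Definition rop_def (R : realType) (o : rop) (b : R) : Prop :=
  if o is RDiv then b != 0 else True.

Definition rop_eval (R : realType) (o : rop) (a b : R) : R :=
  match o with
  | RAdd => a + b
  | RSub => a - b
  | RMul => a * b
  | RDiv => a / b
  end.

(** [exec P s t s']: started in [s], [P] halts in [s'] after [t] operations
    over the reals (arithmetic operations, square roots and comparisons of
    reals).  Index bookkeeping, loading constants and moving data are not
    counted.  A division by zero or the square root of a negative number
    blocks the execution. *)
Inductive exec (R : realType) : prog -> state R -> nat -> state R -> Prop :=
| ExecSkip s :
    exec Skip s 0 s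
| ExecSetReg s x e :
    exec (SetReg x e) s 0 (set_reg s x (ieval (reg s) e))
| ExecLoadCst s d c :
    exec (LoadCst d c) s 0 (set_mem s (ieval (reg s) d) c%:~R)
| ExecMove s d a :
    exec (Move d a) s 0
      (set_mem s (ieval (reg s) d) (mem s (ieval (reg s) a)))
| ExecArith s o d a b :
    rop_def o (mem s (ieval (reg s) b)) ->
    exec (Arith o d a b) s 1
      (set_mem s (ieval (reg s) d)
         (rop_eval o (mem s (ieval (reg s) a)) (mem s (ieval (reg s) b))))
| ExecSqrt s d a :
    0 <= mem s (ieval (reg s) a) ->
    exec (Sqrt d a) s 1
      (set_mem s (ieval (reg s) d) (Num.sqrt (mem s (ieval (reg s) a))))
| ExecSeq P Q s1 t1 s2 t2 s3 :
    exec P s1 t1 s2 -> exec Q s2 t2 s3 -> exec (Seq P Q) s1 (t1 + t2) s3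
| ExecIfIdx a b P Q s t s' :
    exec (if (ieval (reg s) a <= ieval (reg s) b)%N then P else Q) s t s' ->
    exec (IfIdx a b P Q) s t s'
| ExecIfReal a b P Q s t s' :
    exec (if mem s (ieval (reg s) a) <= mem s (ieval (reg s) b) then P else Q)
      s t s' ->
    exec (IfReal a b P Q) s t.+1 s'
| ExecWhileEnd a b P s :
    (ieval (reg s) b <= ieval (reg s) a)%N ->
    exec (While a b P) s 0 s
| ExecWhileStep a b P s1 t1 s2 t2 s3 :
    (ieval (reg s1) a < ieval (reg s1) b)%N ->
    exec P s1 t1 s2 -> exec (While a b P) s2 t2 s3 ->
    exec (While a b P) s1 (t1 + t2) s3.

(** Register 0 holds [n], cells 0, ..., n hold the coordinates of [u], and
    everything else is 0. *)
Definition init (R : realType) (n : nat) (u : 'rV[R]_n.+1) : state R :=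
  State (fun x => if x == 0%N then n else 0%N)
        (fun k => if insub k is Some i then u 0 i else 0).

Definition output (R : realType) (n : nat) (s : state R) : 'rV[R]_n.+1 :=
  \row_(i < n.+1) mem s i.

(** The map [f n u], for [n >= 1] and [u] in R^(n+1), can be computed by one
    program, uniformly in [n], in [O(n log n)] operations. *)
Definition computable_in_nlogn (R : realType)
    (f : forall n : nat, 'rV[R]_n.+1 -> 'rV[R]_n.+1) : Prop :=
  exists (P : prog) (T : nat -> nat),
    (fun n : nat => (T n)%:R : R^o) =O_\oo (fun n : nat => n%:R * ln n%:R : R^o)
    /\ forall (n : nat), (0 < n)%N -> forall u : 'rV[R]_n.+1,
         exists (t : nat) (s : state R),
           [/\ exec P (init u) t s, output n s = f n u & (t <= T n)%N].

(* Main.v *)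
(** Write [u = (t, x)].  For [p = 1], [kappa = 1] and the projection is
    [(t + l, soft l x)]; for [p = +oo], [kappa = sqrt n] and it is
    [(sqrt n * l, clip l x)].  Here [soft l] is coordinatewise soft thresholding,
    [clip l] is truncation to [[-l, l]], and [l] is the least [l >= 0] with
    [sum_i max(0, |x_i| - l) <= b + d l], where [(b, d) = (t, 1)] for [p = 1] and
    [(b, d) = (- sqrt n * t, n)] for [p = +oo].  Optimality is certified by
    [<u - y, y> = 0] and [<u - y, z> <= 0] on the cone.  The sum is
    the maximum over [k] of [S_k - k l], with [S_k] the sum of the [k] largest
    [|x_i|], so [l] is the maximum of [0] and the quotients
    [(S_k - b) / (k + d)]: sorting the [|x_i|] costs [O(n log n)] comparisons,
    and everything else is linear. *)

Require Import Defs.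
From mathcomp Require Import ring lra zify.

Local Open Scope classical_set_scope.
Local Open Scope ring_scope.

(** * Projections and cones *)

Definition dot (R : realType) (n : nat) (x y : 'rV[R]_n) : R :=
  \sum_(i < n) x 0 i * y 0 i.

Lemma dot_ge0 (R : realType) (n : nat) (x : 'rV[R]_n) : 0 <= dot x x.
Proof. by apply: sumr_ge0 => i _; rewrite -expr2 sqr_ge0. Qed.

Lemma dot_eq0 (R : realType) (n : nat) (x : 'rV[R]_n) : dot x x <= 0 -> x = 0.
Proof.
move=> x0; have /eqP : dot x x = 0 by apply/eqP; rewrite eq_le x0 dot_ge0.
rewrite psumr_eq0 => [/allP xx|i _]; last by rewrite -expr2 sqr_ge0.
apply/rowP => i; rewrite mxE; apply/eqP.
by have := xx i (mem_index_enum i); rewrite /= mulf_eq0 orbb.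
Qed.

Lemma lpnorm2E (R : realType) (n : nat) (x : 'rV[R]_n) :
  lpnorm 2%:E x = Num.sqrt (dot x x).
Proof.
rewrite /lpnorm (_ : \sum_(i < n) _ = dot x x) ?powR12_sqrt ?dot_ge0 //.
by apply: eq_bigr => i _; rewrite powR_mulrn // real_normK ?num_real // expr2.
Qed.

Lemma lpnorm1E (R : realType) (n : nat) (x : 'rV[R]_n) :
  lpnorm 1%:E x = \sum_(i < n) `|x 0 i|.
Proof.
rewrite /lpnorm invr1 powRr1; last by apply: sumr_ge0 => i _; rewrite powR_ge0.
by apply: eq_bigr => i _; rewrite powRr1.
Qed.

Lemma lpnormy_leP (R : realType) (n : nat) (x : 'rV[R]_n) (r : R) :
  0 <= r -> (lpnorm +oo x <= r) <-> (forall i, `|x 0 i| <= r).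
Proof.
move=> r0; split=> [/bigmax_leP[_ xr] i|xr]; first exact: xr.
by apply/bigmax_leP.
Qed.

Lemma maximumP (R : realType) (A : set R) (m : R) :
  A m -> ubound A m -> maximum A = m.
Proof.
move=> Am ubm; apply: get_subset1 => // x y [Ax ubx] [Ay uby].
by apply/eqP; rewrite eq_le; apply/andP; split; [apply: uby|apply: ubx].
Qed.

(* [|u - z|^2 = |u - y|^2 + |y - z|^2 - 2 <u - y, z>] if [<u - y, y> = 0]. *)
Lemma proj_eq (R : realType) (n : nat) (A : set 'rV[R]_n) (u y : 'rV[R]_n) :
  A y -> dot (u - y) y = 0 -> (forall z, A z -> dot (u - y) z <= 0) ->
  proj A u = y.
Proof.
move=> Ay uyy uyz.
have pyth z : A z -> dot (u - y) (u - y) + dot (y - z) (y - z)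
    <= dot (u - z) (u - z).
  move=> /uyz; have -> : dot (u - z) (u - z) = dot (u - y) (u - y)
      + dot (y - z) (y - z) + 2 * dot (u - y) y - 2 * dot (u - y) z.
    rewrite /dot !mulr_sumr -!big_split -sumrB; apply: eq_bigr => i _.
    by rewrite !mxE /=; ring.
  by rewrite uyy; lra.
apply: get_subset1.
  split=> [|z /pyth uz]; first exact: Ay.
  rewrite !lpnorm2E ler_sqrt ?dot_ge0 //.
  by have := dot_ge0 (y - z); lra.
suff min_eq z : A z -> (forall w, A w -> lpnorm 2%:E (u - z)
    <= lpnorm 2%:E (u - w)) -> z = y.
  by move=> z w [Az zm] [Aw wm]; rewrite (min_eq z Az zm) (min_eq w Aw wm).
move=> Az /(_ _ Ay); rewrite !lpnorm2E ler_sqrt ?dot_ge0 // => zy.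
apply/esym/eqP; rewrite -subr_eq0; apply/eqP/dot_eq0.
by have := pyth _ Az; lra.
Qed.

Definition behead_row (R : realType) (n : nat) (z : 'rV[R]_n.+1) : 'rV[R]_n :=
  \row_i z 0 (lift ord0 i).

Lemma lift_row0 (R : realType) (n : nat) (k : R) (x : 'rV[R]_n) :
  (row_mx (k%:M : 'M[R]_1) x : 'rV[R]_(1 + n)) 0 (0 : 'I_n.+1) = k.
Proof.
by rewrite -[X in row_mx _ _ _ X](lshift0 n 0) row_mxEl mxE eqxx mulr1n.
Qed.

Lemma lift_rowS (R : realType) (n : nat) (k : R) (x : 'rV[R]_n) (i : 'I_n) :
  (row_mx (k%:M : 'M[R]_1) x : 'rV[R]_(1 + n)) 0 (lift ord0 i) = x 0 i.
Proof. by rewrite -rshift1 row_mxEr. Qed.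

(** The cone is the epigraph of [k * N]: a point with [z 0 0 > 0] reaches height [k] after scaling
    by [k / z 0 0]. A positively homogeneous and definite [N] covers both norms at once. *)
Lemma cone_lift_atP (R : realType) (n : nat) (k : R) (X : set 'rV[R]_n)
    (N : 'rV[R]_n -> R) (z : 'rV[R]_n.+1) :
  0 < k -> (forall x, X x <-> N x <= 1) -> (forall x, 0 <= N x) ->
  (forall a x, 0 <= a -> N (a *: x) = a * N x) ->
  (forall x, N x <= 0 -> x = 0) ->
  cone (lift_at k X) z <-> k * N (behead_row z) <= z 0 0.
Proof.
move=> k0 XN N_ge0 NZ N_eq0; split.
  move=> [a /= a0 [_ [x /XN x1 <-] <-]].
  have -> : behead_row (a *: (row_mx k%:M x : 'rV[R]_(1 + n))) = a *: x.
    by apply/rowP => i; rewrite mxE [LHS]mxE [RHS]mxE lift_rowS.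
  rewrite NZ // mxE lift_row0.
  by rewrite mulrCA ler_wpM2l // ler_piMr // ltW.
move=> zN; have z0 : 0 <= z 0 0 by apply: le_trans zN; rewrite mulr_ge0 // ltW.
pose a := z 0 0 / k; have a0 : 0 <= a by rewrite divr_ge0 // ltW.
have zE (x : 'rV[R]_n) : a *: x = behead_row z ->
    a *: (row_mx k%:M x : 'rV[R]_(1 + n)) = z.
  move=> ax; apply/rowP => i; rewrite mxE.
  case: (unliftP ord0 i) => [j ->|->].
    by rewrite lift_rowS; move/rowP/(_ j): ax; rewrite !mxE.
  by rewrite lift_row0 mulfVK // gt_eqF.
(* At height 0 the bound and definiteness force the tail to vanish, so [z] is 0 times the lift of
   0. *)
have [a_eq0|a_neq0] := eqVneq a 0.
  exists a => //; exists (row_mx k%:M 0 : 'rV[R]_(1 + n)).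
    by exists 0 => //; apply/XN; rewrite -(scale0r 0) NZ // mul0r.
  apply: zE; rewrite a_eq0 scale0r; apply/esym/N_eq0.
  rewrite -(pmulr_rle0 _ k0) (le_trans zN) //.
  move: a_eq0; rewrite /a => /eqP; rewrite mulf_eq0 invr_eq0 (gt_eqF k0) orbF.
  by move=> /eqP ->.
exists a => //; exists (row_mx k%:M (a^-1 *: behead_row z) : 'rV[R]_(1 + n)).
  exists (a^-1 *: behead_row z) => //; apply/XN.
  rewrite NZ ?invr_ge0 // -(ler_pM2l k0) mulr1 mulrCA.
  rewrite ler_pdivrMl ?lt0r ?a_neq0 // mulrC /a mulrC -mulrA mulVf ?mulr1 //.
  by rewrite gt_eqF.
by apply: zE; rewrite scalerA divff // scale1r.
Qed.

Lemma cone_lpball1P (R : realType) (n : nat) (z : 'rV[R]_n.+1) :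
  cone (lift_at 1 (lpball 1%:E n)) z <->
  \sum_(i < n) `|z 0 (lift ord0 i)| <= z 0 0.
Proof.
rewrite (@cone_lift_atP _ _ 1 _ (fun x => \sum_(i < n) `|x 0 i|)) //.
- by rewrite mul1r; under eq_bigr do rewrite mxE.
- by move=> x; rewrite /lpball /mkset lpnorm1E.
- by move=> x; apply: sumr_ge0.
- move=> a x a0; rewrite mulr_sumr; apply: eq_bigr => i _.
  by rewrite mxE normrM ger0_norm.
- move=> x x0; apply/rowP => i; rewrite mxE; apply/eqP; rewrite -normr_le0.
  by apply: le_trans x0; rewrite (bigD1 i) //= lerDl sumr_ge0.
Qed.

Lemma cone_lpballyP (R : realType) (n : nat) (k : R) (z : 'rV[R]_n.+1) :
  (0 < n)%N -> 0 < k ->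
  cone (lift_at k (lpball +oo n)) z <->
  (forall i, k * `|z 0 (lift ord0 i)| <= z 0 0).
Proof.
move=> n0 k0; have Ni_ge0 (x : 'rV[R]_n) : 0 <= lpnorm +oo x.
  exact: bigmax_ge_id.
have ler_norm (x : 'rV[R]_n) i : `|x 0 i| <= lpnorm +oo x.
  by have /lpnormy_leP := lexx (lpnorm +oo x); apply.
rewrite (@cone_lift_atP _ _ k _ (@lpnorm R +oo n)) //.
- rewrite mulrC -ler_pdivlMr //; split=> [zk i|zk].
    rewrite mulrC -ler_pdivlMr //; apply: le_trans zk.
    by have := ler_norm (behead_row z) i; rewrite mxE.
  apply/lpnormy_leP => [|i]; last by rewrite mxE ler_pdivlMr // mulrC.
  (* The sign of [z 0 0] is read off from the bound at one index, which exists because [0 < n]. *)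
  rewrite divr_ge0 ?(ltW k0) //; apply: le_trans (zk (Ordinal n0)).
  by rewrite mulr_ge0 // ltW.
- move=> a x a0; apply/eqP; rewrite eq_le; apply/andP; split.
    apply/lpnormy_leP => [|i]; first by rewrite mulr_ge0.
    by rewrite mxE normrM (ger0_norm a0) ler_wpM2l.
  have [->|a_neq0] := eqVneq a 0; first by rewrite mul0r.
  have a_gt0 : 0 < a by rewrite lt0r a_neq0.
  rewrite mulrC -ler_pdivlMr //; apply/lpnormy_leP => [|i].
    by rewrite divr_ge0.
  rewrite ler_pdivlMr // mulrC.
  by have := ler_norm (a *: x) i; rewrite mxE normrM (ger0_norm a0).
- move=> x x0; apply/rowP => i; rewrite mxE; apply/eqP; rewrite -normr_le0.
  exact: le_trans x0.
Qed.

(** Each entry is at most the whole sum, hence at most 1, and squaring does not increase it. For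
    absolute values this bounds the 2-norm on the ball of the 1-norm. *)
Lemma sum_sqr_le (R : realType) (n : nat) (x : 'I_n -> R) :
  (forall i, 0 <= x i) -> \sum_(i < n) x i <= 1 ->
  \sum_(i < n) x i * x i <= 1.
Proof.
move=> x0 x1; apply: le_trans (x1); apply: ler_sum => i _.
by rewrite ler_piMl // (le_trans _ x1) // (bigD1 i) //= lerDl sumr_ge0.
Qed.

Lemma maximum_lpball1 (R : realType) (n : nat) : (0 < n)%N ->
  maximum [set lpnorm 2%:E x | x in lpball (1%:E : \bar R) n] = 1.
Proof.
case: n => // n _; apply: maximumP.
  exists (delta_mx 0 0).
    rewrite /lpball /mkset lpnorm1E big_ord_recl big1 ?addr0 ?mxE ?normr1 //.
    by move=> i _; rewrite mxE normr0.
  rewrite lpnorm2E /dot big_ord_recl big1 ?addr0 ?mxE ?mulr1 ?sqrtr1 //.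
  by move=> i _; rewrite mxE mul0r.
move=> _ [x x1 <-]; rewrite lpnorm2E -sqrtr1 ler_sqrt ?ler01 //.
move: x1; rewrite /lpball /mkset lpnorm1E => /(sum_sqr_le (fun=> normr_ge0 _)).
by under eq_bigr do rewrite -normrM ger0_norm -?expr2 ?sqr_ge0 // expr2.
Qed.

Lemma maximum_lpbally (R : realType) (n : nat) :
  maximum [set lpnorm 2%:E x | x in lpball (+oo : \bar R) n]
  = Num.sqrt n%:R.
Proof.
apply: maximumP.
  exists (const_mx 1).
    by apply/lpnormy_leP => // i; rewrite mxE normr1.
  rewrite lpnorm2E /dot; under eq_bigr do rewrite mxE mulr1.
  by rewrite sumr_const card_ord.
move=> _ [x /(lpnormy_leP _ ler01) x1 <-]; rewrite lpnorm2E ler_sqrt //.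
have -> : n%:R = \sum_(i < n) 1 :> R by rewrite sumr_const card_ord.
apply: ler_sum => i _; rewrite -[x 0 i * _]ger0_norm -?expr2 ?sqr_ge0 //.
by rewrite normrX exprn_ile1.
Qed.

(** * Clipping and soft thresholding *)

Definition clip (R : realType) (l x : R) : R :=
  if l <= x then l else if x <= - l then - l else x.

(** Both [clip] and [soft] test in the order of [compare_prog], so that machine runs follow them
    branch by branch. *)
Definition soft (R : realType) (l x : R) : R :=
  if l <= x then x - l else if x <= - l then x + l else 0.

Lemma clipDsoft (R : realType) (l x : R) : clip l x + soft l x = x.
Proof. by rewrite /clip /soft; case: ifP => _; [|case: ifP => _]; ring. Qed.

Lemma norm_clip_le (R : realType) (l x : R) : 0 <= l -> `|clip l x| <= l.
Proof.
move=> l0; rewrite ler_norml /clip.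
by case: (lerP l x) => ?; [lra|case: (lerP x (- l)) => ?; lra].
Qed.

Lemma norm_soft (R : realType) (l x : R) : 0 <= l ->
  `|soft l x| = Num.max 0 (`|x| - l).
Proof.
move=> l0; rewrite /soft; case: (lerP l x) => h1; last case: (lerP x (- l)) => h2.
- by rewrite !ger0_norm ?max_r //; lra.
- by rewrite !ler0_norm ?max_r //; lra.
- rewrite normr0 max_l //.
  by rewrite subr_le0 ler_norml; lra.
Qed.

(** Where [soft l x] is nonzero, [clip l x] is [l] with the same sign. Summed over the coordinates,
    this is the equality case of Hölder's inequality, from which orthogonality follows for both
    norms. *)
Lemma clip_mul_soft (R : realType) (l x : R) : 0 <= l ->
  clip l x * soft l x = l * `|soft l x|.
Proof.
move=> l0; rewrite /clip /soft.
case: (lerP l x) => h1; last case: (lerP x (- l)) => h2.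
- by rewrite ger0_norm //; lra.
- by rewrite ler0_norm; lra.
- by rewrite normr0 !mulr0.
Qed.

(** * The Lagrange multiplier *)

Definition excess (R : realType) (s : seq R) (l : R) : R :=
  \sum_(a <- s) Num.max 0 (a - l).

(* The KKT conditions for the multiplier [l] of the constraint. *)
Definition balanced (R : realType) (s : seq R) (b d l : R) : Prop :=
  [/\ 0 <= l, excess s l <= b + d * l & l * excess s l = l * (b + d * l)].

(** The summand dominates both [a - l], used on the first [k] entries, and 0, used on the others. *)
Lemma excess_ge_take (R : realType) (s : seq R) (l : R) (k : nat) :
  (k <= size s)%N -> \sum_(a <- take k s) a - k%:R * l <= excess s l.
Proof.
move=> ks; rewrite /excess -{2}(cat_take_drop k s) big_cat /=.
rewrite -[leLHS]addr0 lerD //; last first.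
  by apply: sumr_ge0 => a _; rewrite le_max lexx.
rewrite [k%:R * l](_ : _ = \sum_(a <- take k s) l); last first.
  by rewrite big_const_seq count_predT size_takel // iter_addr addr0 mulr_natl.
by rewrite -sumrB; apply: ler_sum => a _; rewrite le_max lexx orbT.
Qed.

(** In a decreasing list the entries that are at least [l] form a prefix, and [k] is its length. *)
Lemma excess_eq_take (R : realType) (s : seq R) (l : R) :
  sorted >=%R s -> exists2 k, (k <= size s)%N &
    excess s l = \sum_(a <- take k s) a - k%:R * l.
Proof.
rewrite /excess; elim: s => [|x s IH] sx.
  by exists 0%N => //; rewrite !big_nil mul0r subr0.
have [k ks IHs] := IH (path_sorted sx).
have [lx|xl] := lerP l x.
  exists k.+1 => //=; rewrite !big_cons IHs max_r ?subr_ge0 // -[in RHS]natr1.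
  by ring.
exists 0%N => //; rewrite big_nil mul0r subr0 big_seq big1 //= => a.
rewrite inE => /orP[/eqP ->|as_]; first by rewrite max_l // subr_le0 ltW.
rewrite max_l // subr_le0 (le_trans _ (ltW xl)) //.
have /= := @order_path_min _ >=%R x s => /(_ (fun _ _ _ h1 h2 => le_trans h2 h1)).
by move=> /(_ sx)/allP/(_ a as_).
Qed.

(** Clearing the denominator, [q k <= l] says that [S_k - k l <= b + d l]; the [k] of
    [excess_eq_take] gives the inequality of [balanced]. If [l] is one of the quotients,
    [excess_ge_take] gives the reverse inequality; if [l = 0], complementarity is trivial. *)
Lemma balancedP (R : realType) (s : seq R) (b d l : R) :
  sorted >=%R s -> 0 < d -> 0 <= l ->
  let q k := (\sum_(a <- take k s) a - b) / (k%:R + d) in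
  (forall k, (k <= size s)%N -> q k <= l) ->
  l = 0 \/ (exists2 k, (k <= size s)%N & l = q k) ->
  balanced s b d l.
Proof.
move=> ss d0 l0 q ql lq; have kd k : 0 < k%:R + d.
  by rewrite ltr_wpDl.
have le_ex : excess s l <= b + d * l.
  have [k ks ->] := excess_eq_take l ss.
  have := ql k ks; rewrite /q ler_pdivrMr //; lra.
split=> //; case: lq => [->|[k ks lE]]; first by rewrite !mul0r.
congr (_ * _); apply/eqP; rewrite eq_le le_ex /=.
apply: le_trans (excess_ge_take l ks).
have : l * (k%:R + d) = \sum_(a <- take k s) a - b.
  by rewrite lE /q mulfVK // gt_eqF.
lra.
Qed.

Lemma excess_perm (R : realType) (s t : seq R) (l : R) :
  perm_eq s t -> excess s l = excess t l.
Proof. exact: perm_big. Qed.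

Lemma excess_soft (R : realType) (n : nat) (u : 'rV[R]_n.+1) (l : R) :
  0 <= l -> excess [seq `|u 0 (lift ord0 i)| | i <- enum 'I_n] l =
  \sum_(i < n) `|soft l (u 0 (lift ord0 i))|.
Proof.
move=> l0; rewrite /excess big_map big_enum /=.
by apply: eq_bigr => i _; rewrite norm_soft.
Qed.

(** * The two projections in terms of the multiplier *)

Definition cons_row (R : realType) (n : nat) (t : R) (x : 'I_n -> R) :
    'rV[R]_n.+1 :=
  \row_i if unlift ord0 i is Some j then x j else t.

Lemma cons_row0 (R : realType) (n : nat) (t : R) (x : 'I_n -> R) :
  cons_row t x 0 0 = t.
Proof. by rewrite mxE unlift_none. Qed.

Lemma cons_rowS (R : realType) (n : nat) (t : R) (x : 'I_n -> R) (i : 'I_n) :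
  cons_row t x 0 (lift ord0 i) = x i.
Proof. by rewrite mxE liftK. Qed.

(** The residual is [(- l, clip l x)]. It is in the polar cone because clipped entries are at most
    [l] in absolute value, while the 1-norm of the tail of [z] is at most [z 0 0]. *)
Lemma proj_cone1 (R : realType) (n : nat) (u : 'rV[R]_n.+1) (l : R) :
  balanced [seq `|u 0 (lift ord0 i)| | i <- enum 'I_n] (u 0 0) 1 l ->
  proj (cone (lift_at 1 (lpball 1%:E n))) u =
  cons_row (u 0 0 + l) (fun i => soft l (u 0 (lift ord0 i))).
Proof.
move=> [l0]; rewrite excess_soft // !mul1r => le_ex eq_ex.
have uyE i : u 0 (lift ord0 i) - soft l (u 0 (lift ord0 i))
    = clip l (u 0 (lift ord0 i)).
  by rewrite -[X in X - _](clipDsoft l) addrK.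
apply: proj_eq.
- apply/cone_lpball1P; rewrite cons_row0.
  by under eq_bigr do rewrite cons_rowS.
- rewrite /dot big_ord_recl !mxE unlift_none.
  under eq_bigr do rewrite !mxE liftK uyE clip_mul_soft //.
  by rewrite -mulr_sumr eq_ex; ring.
- move=> z /cone_lpball1P zC.
  rewrite /dot big_ord_recl !mxE unlift_none.
  under eq_bigr do rewrite !mxE liftK uyE.
  have : \sum_(i < n) clip l (u 0 (lift ord0 i)) * z 0 (lift ord0 i)
      <= l * \sum_(i < n) `|z 0 (lift ord0 i)|.
    rewrite mulr_sumr; apply: ler_sum => i _.
    rewrite (le_trans (ler_norm _)) // normrM ler_wpM2r // norm_clip_le //.
  have := ler_wpM2l l0 zC; lra.
Qed.

(** Dual to [proj_cone1]: now [clip] gives the point and [soft] the tail of the residual, so the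
    inequality of [balanced] serves for the polar cone instead of membership. *)
Lemma proj_coney (R : realType) (n : nat) (u : 'rV[R]_n.+1) (l : R) :
  (0 < n)%N ->
  balanced [seq `|u 0 (lift ord0 i)| | i <- enum 'I_n]
    (- (Num.sqrt n%:R * u 0 0)) n%:R l ->
  proj (cone (lift_at (Num.sqrt n%:R) (lpball +oo n))) u =
  cons_row (Num.sqrt n%:R * l) (fun i => clip l (u 0 (lift ord0 i))).
Proof.
move=> n0 [l0]; rewrite excess_soft //; set k := Num.sqrt n%:R.
have kk : k * k = n%:R by rewrite -expr2 sqr_sqrtr.
have k0 : 0 < k by rewrite sqrtr_gt0 ltr0n.
rewrite -kk => le_ex eq_ex.
have uyE i : u 0 (lift ord0 i) - clip l (u 0 (lift ord0 i))
    = soft l (u 0 (lift ord0 i)).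
  by rewrite -[X in X - _](clipDsoft l) addrAC subrr add0r.
apply: proj_eq.
- apply/cone_lpballyP => // i.
  by rewrite cons_row0 cons_rowS ler_wpM2l ?(ltW k0) // norm_clip_le.
- rewrite /dot big_ord_recl !mxE unlift_none.
  under eq_bigr do rewrite !mxE liftK uyE mulrC clip_mul_soft //.
  by rewrite -mulr_sumr eq_ex; ring.
- move=> z /cone_lpballyP zC; have {}zC := zC n0 k0.
  rewrite /dot big_ord_recl !mxE unlift_none.
  under eq_bigr do rewrite !mxE liftK uyE.
  have z0 : 0 <= z 0 0.
    by apply: le_trans (zC (Ordinal n0)); rewrite mulr_ge0 // ltW.
  (* The factor [k] makes the bounds of [zC] applicable; since [0 < k], it does not affect the sign
     of the inner product. *)
  have sz : k * (\sum_(i < n) soft l (u 0 (lift ord0 i)) * z 0 (lift ord0 i))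
      <= z 0 0 * \sum_(i < n) `|soft l (u 0 (lift ord0 i))|.
    rewrite !mulr_sumr; apply: ler_sum => i _.
    rewrite (le_trans (ler_norm _)) // !normrM (gtr0_norm k0) mulrCA mulrC.
    by rewrite ler_wpM2r.
  rewrite -(pmulr_rle0 _ k0); have := ler_wpM2l z0 le_ex; lra.
Qed.

(** * Weakest preconditions *)

(* Weakest precondition of [P] for a postcondition on the final state and the
   number of operations performed so far, [t] of them before [P] starts. *)
Fixpoint wp (R : realType) (P : prog) (Q : nat -> state R -> Prop)
    (t : nat) (s : state R) : Prop :=
  match P with
  | Skip => Q t s
  | SetReg x e => Q t (set_reg s x (ieval (reg s) e))
  | LoadCst d c => Q t (set_mem s (ieval (reg s) d) c%:~R)
  | Move d a =>
      Q t (set_mem s (ieval (reg s) d) (mem s (ieval (reg s) a)))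
  | Arith o d a b =>
      rop_def o (mem s (ieval (reg s) b)) /\
      Q t.+1 (set_mem s (ieval (reg s) d)
        (rop_eval o (mem s (ieval (reg s) a)) (mem s (ieval (reg s) b))))
  | Sqrt d a =>
      0 <= mem s (ieval (reg s) a) /\
      Q t.+1 (set_mem s (ieval (reg s) d)
        (Num.sqrt (mem s (ieval (reg s) a))))
  | Seq P1 P2 => wp P1 (wp P2 Q) t s
  | IfIdx a b P1 P2 =>
      if (ieval (reg s) a <= ieval (reg s) b)%N then wp P1 Q t s
      else wp P2 Q t s
  | IfReal a b P1 P2 =>
      if mem s (ieval (reg s) a) <= mem s (ieval (reg s) b)
      then wp P1 Q t.+1 s else wp P2 Q t.+1 s
  | While _ _ _ => exists t' s', exec P s t' s' /\ Q (t + t')%N s'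
  end.

(* Rules for single instructions: [/=] would also unfold the rest of the program. *)
Lemma wp_seq (R : realType) (P1 P2 : prog) (Q : nat -> state R -> Prop)
    (t : nat) (s : state R) :
  wp P1 (wp P2 Q) t s -> wp (Seq P1 P2) Q t s.
Proof. by []. Qed.

Lemma wp_load (R : realType) (d : iexp) (c : int)
    (Q : nat -> state R -> Prop) (t : nat) (s : state R) :
  Q t (set_mem s (ieval (reg s) d) c%:~R) -> wp (LoadCst d c) Q t s.
Proof. by []. Qed.

Lemma wp_arith (R : realType) (o : rop) (d a b : iexp)
    (Q : nat -> state R -> Prop) (t : nat) (s : state R) :
  rop_def o (mem s (ieval (reg s) b)) ->
  Q t.+1 (set_mem s (ieval (reg s) d)
    (rop_eval o (mem s (ieval (reg s) a)) (mem s (ieval (reg s) b)))) ->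
  wp (Arith o d a b) Q t s.
Proof. by split. Qed.

(** Soundness. The [wp] of a loop is by definition the existence of a run, so that the inductive
    work on loops is left to [wp_while]. *)
Lemma wp_exec (R : realType) (P : prog) (Q : nat -> state R -> Prop)
    (t : nat) (s : state R) :
  wp P Q t s -> exists t' s', exec P s t' s' /\ Q (t + t')%N s'.
Proof.
elim: P Q t s => [|x e|d c|d a|o d a b|d a|P IHP P' IHP'|a b P IHP P' IHP'
  |a b P IHP P' IHP'|a b P IHP] Q t s //=.
- by move=> H; exists 0%N, s; rewrite addn0; split=> //; exact: ExecSkip.
- by move=> H; do 2!eexists; split; [exact: ExecSetReg|rewrite addn0].
- by move=> H; do 2!eexists; split; [exact: ExecLoadCst|rewrite addn0].
- by move=> H; do 2!eexists; split; [exact: ExecMove|rewrite addn0].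
- by move=> [od H]; do 2!eexists; split; [exact: ExecArith|rewrite addn1].
- by move=> [a0 H]; do 2!eexists; split; [exact: ExecSqrt|rewrite addn1].
- move=> /IHP[t1 [s1 [e1 /IHP'[t2 [s2 [e2 H]]]]]].
  exists (t1 + t2)%N, s2; rewrite addnA; split=> //; exact: ExecSeq e1 e2.
- case: ifP => ab; [move=> /IHP|move=> /IHP'] => -[t1 [s1 [e1 H]]];
    by exists t1, s1; split=> //; apply: ExecIfIdx; rewrite ab.
- case: ifP => ab; [move=> /IHP|move=> /IHP'] => -[t1 [s1 [e1 H]]];
    by exists t1.+1, s1; rewrite addnS -addSn; split=> //;
    apply: ExecIfReal; rewrite ab.
Qed.

Lemma wp_mono (R : realType) (P : prog) (Q Q' : nat -> state R -> Prop)
    (t : nat) (s : state R) :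
  (forall t' s', Q t' s' -> Q' t' s') -> wp P Q t s -> wp P Q' t s.
Proof.
elim: P Q Q' t s => [|x e|d c|d a|o d a b|d a|P IHP P' IHP'|a b P IHP P' IHP'
  |a b P IHP P' IHP'|a b P IHP] Q Q' t s QQ' /=; try exact: QQ'.
- by move=> [od /QQ'].
- by move=> [od /QQ'].
- by apply: IHP => t' s'; apply: IHP'.
- by case: ifP => _; [apply: IHP|apply: IHP'].
- by case: ifP => _; [apply: IHP|apply: IHP'].
- by move=> [t' [s' [e /QQ' ?]]]; exists t', s'.
Qed.

(** The index of the invariant is a variant: each round lowers it and costs at most [c], which
    yields termination and the bound [k * c] together. *)
Lemma wp_while (R : realType) (a b : iexp) (P : prog) (c : nat)
    (I : nat -> state R -> Prop) (k t : nat) (s : state R) :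
  (forall k s t, I k s -> (ieval (reg s) a < ieval (reg s) b)%N ->
    wp P (fun t' s' => (t' <= t + c)%N /\ exists2 k', (k' < k)%N & I k' s')
      t s) ->
  I k s ->
  wp (While a b P) (fun t' s' => [/\ (t' <= t + k * c)%N,
    (ieval (reg s') b <= ieval (reg s') a)%N & exists k', I k' s']) t s.
Proof.
move=> step; elim/ltn_ind: k t s => k IH t s Iks /=.
have [ab|ba] := ltnP (ieval (reg s) a) (ieval (reg s) b); last first.
  exists 0%N, s; split; first exact: ExecWhileEnd.
  by split=> //; [rewrite addn0 leq_addr|exists k].
have [t1 [s1 [e1 [t1c [k' k'k Ik']]]]] := wp_exec (step k s t Iks ab).
have /= [t2 [s2 [e2 [t2c ba Is2]]]] := IH k' k'k (t + t1)%N s1 Ik'.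
exists (t1 + t2)%N, s2; split; first exact: ExecWhileStep ab e1 e2.
split=> //; rewrite addnA (leq_trans t2c) //.
have : (k'.+1 * c <= k * c)%N by rewrite leq_mul2r k'k orbT.
rewrite mulSn; lia.
Qed.

Lemma update_eq (T : Type) (f : nat -> T) (k : nat) (v : T) (i : nat) :
  i = k -> update f k v i = v.
Proof. by move=> ->; rewrite /update eqxx. Qed.

Lemma update_ne (T : Type) (f : nat -> T) (k : nat) (v : T) (i : nat) :
  i <> k -> update f k v i = f i.
Proof. by move=> /eqP/negPf ik; rewrite /update ik. Qed.

Ltac update_simp := repeat match goal with
  |- context [@update ?T ?f ?k ?v ?i] =>
    first [ rewrite (@update_eq T f k v i); [|lia]
          | rewrite (@update_ne T f k v i); [|lia] ]
  end.

(** * Sorting *)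

(* Register 0 holds [n]; cells [n+1 .. 2n] hold the sorted absolute values, and
   cells from [2n+1] on hold scalars. Register 1 is the loop counter. *)
Definition xcell : iexp := IAdd (IReg 1) (ICst 1).
Definition acell (e : iexp) : iexp := IAdd (IAdd (IReg 0) (ICst 1)) e.
Definition scell (j : nat) : iexp := IAdd (IMul (ICst 2) (IReg 0)) (ICst j.+1).

Definition for_prog (P : prog) : prog :=
  Seq (SetReg 1 (ICst 0))
    (While (IReg 1) (IReg 0) (Seq P (SetReg 1 (IAdd (IReg 1) (ICst 1))))).

Lemma wp_for (R : realType) (P : prog) (n c : nat)
    (I : nat -> (nat -> R) -> Prop) (t : nat) (s : state R) :
  (forall i s t, (i < n)%N -> reg s 0 = n -> reg s 1 = i -> I i (mem s) ->
    wp P (fun t' s' => [/\ (t' <= t + c)%N, reg s' 0 = n, reg s' 1 = i &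
      I i.+1 (mem s')]) t s) ->
  reg s 0 = n -> I 0 (mem s) ->
  wp (for_prog P) (fun t' s' =>
    [/\ (t' <= t + n * c)%N, reg s' 0 = n & I n (mem s')]) t s.
Proof.
move=> step s0 I0.
(* The variant is the number of rounds still to run. *)
pose J k s := [/\ reg s 0 = n, (reg s 1 + k = n)%N & I (reg s 1) (mem s)].
suff : wp (While (IReg 1) (IReg 0)
    (Seq P (SetReg 1 (IAdd (IReg 1) (ICst 1))))) (fun t' s' =>
    [/\ (t' <= t + n * c)%N, (ieval (reg s') (IReg 0) <= ieval (reg s') (IReg 1))%N
      & exists k', J k' s']) t (set_reg s 1 0).
  apply: wp_mono => t' s' [t'c /= s'n [k' [s'0 s'1 In]]]; split=> //.
  by rewrite (_ : n = reg s' 1) //; lia.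
apply: wp_while; last by split.
move=> k s1 t1 [h0 h1 hI] /= lt.
apply: wp_mono (step _ _ t1 _ h0 (erefl _) hI); last by lia.
move=> t' s' [t'c h0' h1' hI'] /=; split=> //; exists k.-1; first by lia.
by rewrite /J /= /update /= h0' h1' addn1; split=> //; lia.
Qed.

(** Binary search for the place of scalar 0 in the decreasing array, between the bounds in registers
    2 and 3. *)
Definition search_prog : prog :=
  Seq (Seq (SetReg 2 (ICst 0)) (SetReg 3 (IReg 1)))
    (While (IReg 2) (IReg 3)
      (Seq (SetReg 4 (IDiv (IAdd (IReg 2) (IReg 3)) (ICst 2)))
        (IfReal (scell 0) (acell (IReg 4))
          (SetReg 2 (IAdd (IReg 4) (ICst 1)))
          (SetReg 3 (IReg 4))))).

Definition is_array (R : realType) (n : nat) (xs : seq R) (m : nat -> R) :=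
  forall k, (k < size xs)%N -> m (n + 1 + k)%N = xs`_k.

Lemma wp_search (R : realType) (n L : nat) (xs : seq R) (t : nat)
    (s : state R) :
  sorted >=%R xs -> is_array n xs (mem s) -> (size xs < 2 ^ L)%N ->
  reg s 0 = n -> reg s 1 = size xs ->
  wp search_prog (fun t' s' => (t' <= t + L)%N /\
    [/\ reg s' 0 = n, reg s' 1 = size xs, mem s' = mem s &
      [/\ (reg s' 2 <= size xs)%N,
        forall k, (k < reg s' 2)%N -> mem s (2 * n + 1)%N <= xs`_k
      & forall k, (reg s' 2 <= k < size xs)%N ->
          xs`_k <= mem s (2 * n + 1)%N]]) t s.
Proof.
move=> sxs arr szL s0 s1; set x := mem s (2 * n + 1)%N.
(* The width of the interval is below [2 ^ k], so halving lowers [k] by one; the loop condition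
   excludes [k = 0]. *)
pose I k s' := [/\ reg s' 0 = n, reg s' 1 = size xs, mem s' = mem s,
  (reg s' 3 - reg s' 2 < 2 ^ k)%N &
  [/\ (reg s' 2 <= reg s' 3 <= size xs)%N,
    forall k, (k < reg s' 2)%N -> x <= xs`_k
  & forall k, (reg s' 3 <= k < size xs)%N -> xs`_k <= x]].
have xs_mono i j : (i <= j < size xs)%N -> xs`_j <= xs`_i.
  move=> /andP[ij js].
  by apply: (sorted_leq_nth ge_trans ge_refl 0 sxs) => //; rewrite inE /=; lia.
apply: (@wp_mono _ _ (fun t' s' => [/\ (t' <= t + L * 1)%N,
  (ieval (reg s') (IReg 3) <= ieval (reg s') (IReg 2))%N
  & exists k', I k' s'])).
  move=> t' s' [tt /= h [k' [h0 h1 hm _ [h23 hl hr]]]]; split; first by lia.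
  split=> //; split=> //; first by lia.
  by move=> k hk; apply: hr; lia.
apply/wp_seq; rewrite [wp _ _ _ _]/=.
apply: wp_while; last first.
  by rewrite /I /= /update /= subn0 s0 s1; split=> //; split=> // k; lia.
move=> k sk tk [h0 h1 hm hk [h23 hl hr]] /= lt.
rewrite /update /= h0 hm arr; last by lia.
set p := ((reg sk 2 + reg sk 3) %/ 2)%N.
have p23 : (reg sk 2 <= p < reg sk 3)%N by rewrite /p; lia.
case: k hk => [|k hk]; first by rewrite expn0; lia.
rewrite expnS in hk.
case: ifP => hx; (split; first by lia); exists k => //;
  rewrite /I /= /update /=; split=> //; try by rewrite /p; lia.
- split=> // [|i ip]; first by lia.
  by apply: le_trans hx _; apply: xs_mono; lia.
- split=> // [|i ip]; first by lia.
  by apply: (@le_trans _ _ xs`_p); [apply: xs_mono; lia|rewrite ltW // ltNge hx].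
Qed.

(** Works from the top down, so that each cell is read before it is overwritten. *)
Definition shift_prog : prog :=
  Seq (SetReg 4 (IReg 1))
    (While (IReg 2) (IReg 4)
      (Seq (Move (acell (IReg 4)) (acell (ISub (IReg 4) (ICst 1))))
        (SetReg 4 (ISub (IReg 4) (ICst 1))))).

Lemma wp_shift (R : realType) (n i : nat) (t : nat) (s : state R) :
  reg s 0 = n -> reg s 1 = i -> (reg s 2 <= i)%N ->
  wp shift_prog (fun t' s' => (t' <= t)%N /\
    [/\ reg s' 0 = n, reg s' 1 = i, reg s' 2 = reg s 2 &
      [/\ forall k, (k < n + 1 + reg s 2)%N -> mem s' k = mem s k,
        forall k, (n + 1 + i < k)%N -> mem s' k = mem s k
      & forall k, (reg s 2 < k <= i)%N ->
          mem s' (n + 1 + k)%N = mem s (n + 1 + k.-1)%N]]) t s.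
Proof.
move=> s0 s1 s2.
(* Here [j] cells remain to be moved, and everything up to cell [n + 1 + reg s 2 + j] is still as at
   the start. *)
pose I j s' := [/\ reg s' 0 = n, reg s' 1 = i, reg s' 2 = reg s 2,
  reg s' 4 = (reg s 2 + j)%N & [/\ (reg s 2 + j <= i)%N,
    forall k, (k < n + 1 + reg s 2 + j.+1)%N -> mem s' k = mem s k,
    forall k, (n + 1 + i < k)%N -> mem s' k = mem s k
  & forall k, (reg s 2 + j < k <= i)%N ->
      mem s' (n + 1 + k)%N = mem s (n + 1 + k.-1)%N]].
apply: (@wp_mono _ _ (fun t' s' => [/\ (t' <= t + (i - reg s 2) * 0)%N,
  (ieval (reg s') (IReg 4) <= ieval (reg s') (IReg 2))%N
  & exists k', I k' s'])).
  move=> t' s' [tt /= h [k' [h0 h1 h2 h4 [hi hl hr hm]]]]; split; first by lia.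
  split=> //; split=> // k hk; first by apply: hl; lia.
  by apply: hm; lia.
apply/wp_seq; rewrite [wp _ _ _ _]/=.
apply: wp_while; last first.
  rewrite /I /= /update /= s0 s1; split=> //; first by lia.
  by split=> [|//|//|k]; lia.
move=> j sk tk [h0 h1 h2 h4 [hi hl hr hm]] /= lt.
rewrite h0 h4; split; first by lia.
case: j hi hl hm h4 => [|j] hi hl hm h4; first by lia.
exists j => //; rewrite /I /= ![@update nat _ _ _ _]/update /=.
rewrite h0 h1 h2 (_ : (reg s 2 + j.+1 - 1)%N = (reg s 2 + j)%N); last by lia.
rewrite /=; split=> //; split; first by lia.
- by move=> k hk; update_simp; apply: hl; lia.
- by move=> k hk; update_simp; apply: hr; lia.
- move=> k hk; have [kj|kj] := eqVneq k (reg s 2 + j.+1)%N.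
    by rewrite update_eq ?kj ?hl; [congr (mem s _)| |]; lia.
  by update_simp; apply: hm; lia.
Qed.

(* Binary insertion: moving cells is not counted, so that inserting costs only
   the comparisons of the binary search. *)
Definition insert_prog : prog :=
  Seq (Seq (LoadCst (scell 0) 0)
    (IfReal (scell 0) xcell (Move (scell 0) xcell)
      (Arith RSub (scell 0) (scell 0) xcell)))
  (Seq search_prog (Seq shift_prog (Move (acell (IReg 2)) (scell 0)))).

Definition sort_prog : prog := for_prog insert_prog.

Definition sort_inv (R : realType) (n : nat) (U : nat -> R) (i : nat)
    (m : nat -> R) : Prop :=
  (forall k, (k <= n)%N -> m k = U k) /\
  exists xs, [/\ is_array n xs m, sorted >=%R xs &
    perm_eq xs [seq `|U k.+1| | k <- iota 0 i]].

Lemma nth_insert (T : Type) (x0 x : T) (xs : seq T) (p k : nat) :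
  (p <= size xs)%N ->
  nth x0 (take p xs ++ x :: drop p xs) k =
  if (k < p)%N then nth x0 xs k else if k == p then x else nth x0 xs k.-1.
Proof.
move=> ps; rewrite nth_cat size_takel //; case: ltnP => kp.
  by rewrite nth_take.
have [->|kp'] := eqVneq k p; first by rewrite subnn.
rewrite (_ : k - p = (k - p).-1.+1)%N /= ?nth_drop; last by lia.
by congr nth; lia.
Qed.

Lemma sorted_insert (R : realType) (x : R) (xs : seq R) (p : nat) :
  sorted >=%R xs -> (p <= size xs)%N ->
  (forall k, (k < p)%N -> x <= xs`_k) ->
  (forall k, (p <= k < size xs)%N -> xs`_k <= x) ->
  sorted >=%R (take p xs ++ x :: drop p xs).
Proof.
move=> /(sortedP 0) sxs_nth ps xl xr; apply/(sortedP 0) => k.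
have sxs i : (i.+1 < size xs)%N -> xs`_i.+1 <= xs`_i := sxs_nth i.
rewrite size_cat /= size_takel // size_drop !nth_insert //= => ks.
case: (ltnP k p) => kp; case: (ltnP k.+1 p) => kp'; try lia.
- by apply: sxs; lia.
- by rewrite (_ : k.+1 == p); [apply: xl|lia].
- rewrite (_ : (k.+1 == p) = false); last by lia.
  have [kE|kp''] := eqVneq k p; first by apply: xr; lia.
  by have := sxs k.-1; rewrite prednK; [apply|]; lia.
Qed.

(** The absolute value takes at most 2 operations, the search at most [L] comparisons, and the shift
    none. *)
Lemma wp_insert (R : realType) (n L i : nat) (U : nat -> R) (t : nat)
    (s : state R) :
  (i < n)%N -> (i < 2 ^ L)%N -> reg s 0 = n -> reg s 1 = i ->
  sort_inv n U i (mem s) ->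
  wp insert_prog (fun t' s' => [/\ (t' <= t + (L + 2))%N, reg s' 0 = n,
    reg s' 1 = i & sort_inv n U i.+1 (mem s')]) t s.
Proof.
move=> ni iL s0 s1 [mU [xs [arr sxs pxs]]].
have sz : size xs = i by rewrite (perm_size pxs) size_map size_iota.
(* Common continuation of the two sign cases of the absolute value. *)
have step t1 s1' : (t1 <= t + 2)%N -> reg s1' 0 = n -> reg s1' 1 = i ->
    (forall k, (k < 2 * n + 1)%N -> mem s1' k = mem s k) ->
    mem s1' (2 * n + 1)%N = `|U i.+1| ->
    wp (Seq search_prog (Seq shift_prog (Move (acell (IReg 2)) (scell 0))))
      (fun t' s' => [/\ (t' <= t + (L + 2))%N, reg s' 0 = n,
        reg s' 1 = i & sort_inv n U i.+1 (mem s')]) t1 s1'.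
  move=> t1t h0 h1 hm hx.
  have arr1 : is_array n xs (mem s1').
    by move=> k kx; rewrite hm ?arr //; lia.
  have szL : (size xs < 2 ^ L)%N by rewrite sz.
  have h1' : reg s1' 1 = size xs by rewrite sz.
  apply: wp_seq; apply: wp_mono (wp_search t1 sxs arr1 szL h0 h1'); rewrite sz.
  move=> t2 s2 [t21 [g0 g1 gm [p2 hl hr]]].
  apply: wp_seq; apply: wp_mono (@wp_shift _ n i t2 s2 g0 g1 p2).
  move=> t3 s3 [t32 [k0 k1 k2 [fl fr fm]]]; split=> //=; first by lia.
  rewrite k0 k2; set p := reg s2 2 in p2 hl hr fl fm *.
  rewrite !gm hx in hl hr fl fr fm *.
  split.
    by move=> k kn; update_simp; rewrite fl ?hm ?mU //; lia.
  exists (take p xs ++ `|U i.+1| :: drop p xs); split.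
  - move=> k; rewrite size_cat /= size_takel ?sz // size_drop sz => ks.
    rewrite nth_insert ?sz //.
    have [->|kp] := eqVneq k p.
      by rewrite ltnn update_eq //  fr ?hx //; lia.
    update_simp; case: ltnP => kp'.
      by rewrite fl ?arr1 ?sz //; lia.
    by rewrite fm ?arr1 ?sz //; lia.
  - apply: sorted_insert; rewrite ?sz //.
  - rewrite -addn1 iotaD map_cat /= add0n cats1.
    rewrite -[_ :: drop _ _]cat1s perm_catCA cat_take_drop cat1s.
    by rewrite perm_sym perm_rcons addn1 perm_cons perm_sym.
rewrite /insert_prog; cbn [wp]; rewrite /= s0 s1.
case: ifP => cmp.
  apply: step => //=; [by lia| |].
    by move=> k kn; update_simp.
  rewrite update_eq // update_ne; last by lia.
  move: cmp; rewrite update_eq // update_ne; last by lia.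
  rewrite mU ?addn1; [move=> h; rewrite ger0_norm //|lia].
split=> //; apply: step => //=; [by lia| |].
  by move=> k kn; update_simp.
rewrite update_eq // update_eq // update_ne; last by lia.
move: cmp; rewrite update_eq // update_ne; last by lia.
rewrite mU ?addn1; last by lia.
by move=> /negbT; rewrite -ltNge => h; rewrite ltr0_norm // sub0r.
Qed.

Lemma wp_sort (R : realType) (n L : nat) (U : nat -> R) (t : nat)
    (s : state R) :
  (n <= 2 ^ L)%N -> reg s 0 = n -> (forall k, (k <= n)%N -> mem s k = U k) ->
  wp sort_prog (fun t' s' => [/\ (t' <= t + n * (L + 2))%N, reg s' 0 = n &
    sort_inv n U n (mem s')]) t s.
Proof.
move=> nL s0 mU; apply: (@wp_for _ _ n _ (sort_inv n U)) => //.
  move=> i s1 t1 ni h0 h1 hI; apply: wp_insert => //; exact: leq_trans nL.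
by split=> //; exists [::].
Qed.

(** * The program *)

(* Scalar 1 holds the numerator [S_k - b], scalar 2 the denominator [k + d],
   scalar 3 the current maximum, scalar 4 the constant 1; in the case
   [p = +oo], scalar 5 holds [sqrt n]. *)
Definition improve_prog : prog :=
  Seq (Arith RDiv (scell 0) (scell 1) (scell 2))
    (IfReal (scell 3) (scell 0) (Move (scell 3) (scell 0)) Skip).

Definition threshold_prog : prog :=
  Seq (Seq (LoadCst (scell 3) 0) (LoadCst (scell 4) 1))
  (Seq improve_prog
    (for_prog (Seq (Seq
      (Arith RAdd (scell 1) (scell 1) (acell (IReg 1)))
      (Arith RAdd (scell 2) (scell 2) (scell 4)))
      improve_prog))).

Definition quotient_max (R : realType) (q : nat -> R) (i : nat) (l : R) :=
  [/\ 0 <= l, forall k, (k < i)%N -> q k <= l &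
    l = 0 \/ exists2 k, (k < i)%N & l = q k].

Lemma quotient_maxS (R : realType) (q : nat -> R) (i : nat) (l : R) :
  quotient_max q i l ->
  quotient_max q i.+1 (if l <= q i then q i else l).
Proof.
move=> [l0 ql lq]; case: ifP => lqi; split.
- exact: le_trans lqi.
- move=> k; rewrite ltnS leq_eqVlt => /orP[/eqP-> //|/ql h].
  exact: le_trans lqi.
- by right; exists i.
- by [].
- move=> k; rewrite ltnS leq_eqVlt => /orP[/eqP->|/ql //].
  by rewrite ltW // ltNge lqi.
- by case: lq => [|[k ki]]; [left|right; exists k => //; exact: ltnW].
Qed.

(** These cells are the input and the sorted array; the scalars lie above them. *)
Definition same_below (R : realType) (n : nat) (m m' : nat -> R) : Prop :=
  forall k, (k <= 2 * n)%N -> m' k = m k.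

Lemma wp_improve (R : realType) (n t : nat) (s : state R) :
  reg s 0 = n -> mem s (2 * n + 3)%N != 0 ->
  wp improve_prog (fun t' s' => [/\ (t' <= t + 2)%N, reg s' = reg s,
    same_below n (mem s) (mem s') &
    [/\ mem s' (2 * n + 2)%N = mem s (2 * n + 2)%N,
      mem s' (2 * n + 3)%N = mem s (2 * n + 3)%N,
      mem s' (2 * n + 5)%N = mem s (2 * n + 5)%N,
      mem s' (2 * n + 6)%N = mem s (2 * n + 6)%N
    & let q := mem s (2 * n + 2)%N / mem s (2 * n + 3)%N in
      mem s' (2 * n + 4)%N =
        if mem s (2 * n + 4)%N <= q then q else mem s (2 * n + 4)%N]]) t s.
Proof.
move=> s0 d0; rewrite /improve_prog /= s0; split=> //.
update_simp; case: ifP => h.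
  split=> //; first by lia.
    by move=> k kn /=; update_simp.
  by split=> /=; update_simp; rewrite ?h.
split=> //; first by lia.
  by move=> k kn /=; update_simp.
by split=> /=; update_simp; rewrite ?h.
Qed.

(** The first [improve_prog] treats [k = 0] at a cost of 2; each of the [n] rounds adds two
    additions to a division and a comparison. *)
Lemma wp_threshold (R : realType) (n t : nat) (s : state R) (xs : seq R)
    (b d : R) :
  reg s 0 = n -> size xs = n -> is_array n xs (mem s) -> 0 < d ->
  mem s (2 * n + 2)%N = - b -> mem s (2 * n + 3)%N = d ->
  let q k := (\sum_(a <- take k xs) a - b) / (k%:R + d) in
  wp threshold_prog (fun t' s' => [/\ (t' <= t + (2 + n * 4))%N, reg s' 0 = n,
    same_below n (mem s) (mem s'), mem s' (2 * n + 6)%N = mem s (2 * n + 6)%N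
  & quotient_max q n.+1 (mem s' (2 * n + 4)%N)]) t s.
Proof.
move=> s0 sz arr d0 sb sd q.
(* After [i] rounds scalars 1 and 2 hold the numerator and denominator of [q i], and [q i] has
   already entered the maximum. *)
pose I i m := [/\ same_below n (mem s) m,
  m (2 * n + 2)%N = \sum_(a <- take i xs) a - b, m (2 * n + 3)%N = i%:R + d,
  m (2 * n + 5)%N = 1 & m (2 * n + 6)%N = mem s (2 * n + 6)%N /\
  quotient_max q i.+1 (m (2 * n + 4)%N)].
have kd k : k%:R + d != 0 by rewrite gt_eqF // ltr_wpDl.
do 2!apply: wp_seq; do 2!apply: wp_load; apply: wp_seq.
apply: wp_mono (@wp_improve _ n t _ _ _) => [|//|]; last first.
  by rewrite /= s0; update_simp; rewrite sd -[d]add0r (kd 0%N).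
move=> t1 s1 [t1t h0 hm [h2 h3 h5 h6 h4]].
rewrite /= s0 in h0 hm h2 h3 h5 h6 h4.
move: h2 h3 h5 h6 h4; update_simp => h2 h3 h5 h6 h4.
apply: (wp_mono _ (@wp_for R _ n 4 I t1 s1 _ _ _)) => [t2 s2|||].
- by move=> [t21 g0 [hs _ _ _ [g6 g4]]]; split=> //; lia.
- move=> i si ti ni r0 r1 [gm g2 g3 g5 [g6 g4]].
  do 2!apply: wp_seq; do 2!apply: wp_arith => //.
  apply: wp_mono (@wp_improve _ n _ _ _ _) => [|//|]; rewrite /= r0 r1; last first.
    by update_simp; rewrite g3 g5 addrAC natr1 kd.
  have arri : mem si (n + 1 + i)%N = xs`_i.
    by rewrite gm ?arr ?sz //; lia.
  move=> t2 s2 [t21 -> hs]; update_simp; rewrite g2 g3 g5 arri.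
  have -> : \sum_(a <- take i xs) a - b + xs`_i = \sum_(a <- take i.+1 xs) a - b.
    by rewrite (take_nth 0) ?sz // -cats1 big_cat big_seq1 addrAC.
  have -> : i%:R + d + 1 = i.+1%:R + d by rewrite addrAC natr1.
  move=> [j2 j3 j5 j6 j4]; split=> //; first by lia.
  split=> //; last by rewrite j6 j4; split=> //; apply: quotient_maxS.
  by move=> k kn; rewrite hs // update_ne ?update_ne ?gm //; lia.
- by rewrite h0.
- split; rewrite ?take0 ?big_nil ?sub0r ?add0r //.
  + by move=> k kn; rewrite hm //; update_simp.
  + by rewrite h2 sb.
  + by rewrite h3 sd.
  split=> //; rewrite h4 sb sd.
  have -> : - b / d = q 0%N by rewrite /q take0 big_nil sub0r add0r.
  by apply: quotient_maxS; split=> //; left.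
Qed.

(** The phase shared by both norms. The predicate [K] carries what [setup] leaves in scalar 5
    through to the output phase. *)
Lemma wp_balance (R : realType) (n L c : nat) (U : nat -> R) (b d : R)
    (K : R -> Prop) (setup : prog) (t : nat) (s : state R) :
  (n <= 2 ^ L)%N -> 0 < d ->
  (forall t s, reg s 0 = n -> mem s 0%N = U 0%N ->
    wp setup (fun t' s' => [/\ (t' <= t + c)%N, reg s' 0 = n,
      same_below n (mem s) (mem s') &
      [/\ mem s' (2 * n + 2)%N = - b, mem s' (2 * n + 3)%N = d &
        K (mem s' (2 * n + 6)%N)]]) t s) ->
  reg s 0 = n -> (forall k, (k <= n)%N -> mem s k = U k) ->
  wp (Seq sort_prog (Seq setup threshold_prog)) (fun t' s' =>
    [/\ (t' <= t + (n * (L + 2) + c + (2 + n * 4)))%N, reg s' 0 = n,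
      forall k, (k <= n)%N -> mem s' k = U k,
      balanced [seq `|U k.+1| | k <- iota 0 n] b d (mem s' (2 * n + 4)%N)
    & K (mem s' (2 * n + 6)%N)]) t s.
Proof.
move=> nL d0 hsetup s0 mU.
apply: wp_seq; apply: wp_mono (wp_sort t nL s0 mU).
move=> t1 s1 [t1t h0 [mU1 [xs [arr sxs pxs]]]].
have sz : size xs = n by rewrite (perm_size pxs) size_map size_iota.
apply: wp_seq; apply: wp_mono (hsetup t1 s1 h0 (mU1 0%N (leq0n n))).
move=> t2 s2 [t21 g0 sb [gb gd gK]].
have arr2 : is_array n xs (mem s2).
  by move=> k kx; rewrite sb ?arr //; rewrite sz in kx; lia.
apply: wp_mono (wp_threshold t2 g0 sz arr2 d0 gb gd).
move=> t3 s3 [t32 k0 sb3 k6 [l0 ql lq]]; split=> //; first by lia.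
- by move=> k kn; rewrite sb3 ?sb ?mU1 //; lia.
- have [] : balanced xs b d (mem s3 (2 * n + 4)%N) by apply: balancedP; rewrite ?sz.
  by rewrite (excess_perm _ pxs) => bl1 bl2 bl3; split.
- by rewrite k6.
Qed.

(** Memories are compared pointwise, since the [Skip] branch of [clip_prog] performs no update at
    all. *)
Lemma wp_map (R : realType) (n c : nat) (l : R) (f : R -> R) (P : prog)
    (t : nat) (s : state R) :
  (forall i s t, (i < n)%N -> reg s 0 = n -> reg s 1 = i ->
    mem s (2 * n + 1)%N = - l -> mem s (2 * n + 4)%N = l ->
    wp P (fun t' s' => [/\ (t' <= t + c)%N, reg s' = reg s &
      mem s' =1 update (mem s) i.+1 (f (mem s i.+1))]) t s) ->
  reg s 0 = n -> mem s (2 * n + 1)%N = - l -> mem s (2 * n + 4)%N = l ->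
  wp (for_prog P) (fun t' s' => [/\ (t' <= t + n * c)%N,
    mem s' 0%N = mem s 0%N &
    forall i, (i < n)%N -> mem s' i.+1 = f (mem s i.+1)]) t s.
Proof.
move=> hP s0 s1 s4.
(* The unchanged cells beyond [i] include the scalars that hold [l] and [- l]. *)
pose I i m := [/\ forall k, (i < k)%N -> m k = mem s k, m 0%N = mem s 0%N &
  forall k, (k < i)%N -> m k.+1 = f (mem s k.+1)].
apply: (wp_mono _ (@wp_for R P n c I t s _ s0 _)) => [t' s' [? _ [_ ? ?]] //||].
  move=> i si ti ni r0 r1 [mr m0 ml].
  apply: (wp_mono _ (hP i si ti ni r0 r1 _ _)) => [t' s' [tt' rr mm]||].
  - rewrite rr; split=> //; split=> [k ik||k ki]; rewrite mm.
    + by update_simp; apply: mr; lia.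
    + by update_simp.
    + have [->|ki'] := eqVneq k i; first by rewrite update_eq // mr.
      by update_simp; apply: ml; lia.
  - by rewrite mr //; lia.
  - by rewrite mr //; lia.
by split.
Qed.

(** * Setup and output phases for the two norms *)

Definition compare_prog (P1 P2 P3 : prog) : prog :=
  IfReal (scell 3) xcell P1 (IfReal xcell (scell 0) P2 P3).

Definition soft_prog : prog :=
  compare_prog (Arith RSub xcell xcell (scell 3))
    (Arith RAdd xcell xcell (scell 3)) (LoadCst xcell 0).

Definition clip_prog : prog :=
  compare_prog (Move xcell (scell 3)) (Move xcell (scell 0)) Skip.

Lemma wp_soft (R : realType) (n i : nat) (l : R) (t : nat) (s : state R) :
  (i < n)%N -> reg s 0 = n -> reg s 1 = i ->
  mem s (2 * n + 1)%N = - l -> mem s (2 * n + 4)%N = l ->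
  wp soft_prog (fun t' s' => [/\ (t' <= t + 3)%N, reg s' = reg s &
    mem s' =1 update (mem s) i.+1 (soft l (mem s i.+1))]) t s.
Proof.
move=> ni r0 r1 m1 m4; rewrite /soft /= r0 r1 m1 m4 addn1.
case: ifP => h1; first by do 2?[split=> //]; rewrite ?h1 //; lia.
by case: ifP => h2; do 2?[split=> //]; rewrite ?h1 ?h2 //; lia.
Qed.

Lemma wp_clip (R : realType) (n i : nat) (l : R) (t : nat) (s : state R) :
  (i < n)%N -> reg s 0 = n -> reg s 1 = i ->
  mem s (2 * n + 1)%N = - l -> mem s (2 * n + 4)%N = l ->
  wp clip_prog (fun t' s' => [/\ (t' <= t + 3)%N, reg s' = reg s &
    mem s' =1 update (mem s) i.+1 (clip l (mem s i.+1))]) t s.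
Proof.
move=> ni r0 r1 m1 m4; rewrite /clip /= r0 r1 m1 m4 addn1.
case: ifP => h1; first by split; rewrite ?h1 //; lia.
case: ifP => h2; split; rewrite ?h1 ?h2 //; try by lia.
by move=> k /=; rewrite /update; case: eqP => [->|].
Qed.

Definition negate_prog : prog :=
  Seq (LoadCst (scell 0) 0) (Arith RSub (scell 0) (scell 0) (scell 3)).

Definition setup1_prog : prog :=
  Seq (Seq (LoadCst (scell 0) 0) (Arith RSub (scell 1) (scell 0) (ICst 0)))
    (LoadCst (scell 2) 1).

Definition output1_prog : prog :=
  Seq negate_prog
    (Seq (Arith RAdd (ICst 0) (ICst 0) (scell 3)) (for_prog soft_prog)).

(** No instruction turns a register into a real, so the real number [n] is obtained by adding 1 to
    itself in a loop. *)
Definition setupy_prog : prog :=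
  Seq (Seq (LoadCst (scell 2) 0) (LoadCst (scell 4) 1))
  (Seq (for_prog (Arith RAdd (scell 2) (scell 2) (scell 4)))
    (Seq (Sqrt (scell 5) (scell 2))
      (Arith RMul (scell 1) (scell 5) (ICst 0)))).

Definition outputy_prog : prog :=
  Seq negate_prog
    (Seq (Arith RMul (ICst 0) (scell 5) (scell 3)) (for_prog clip_prog)).

(** The generous bound [n + 2] and the final [True] give this the same shape as [wp_setupy], for use
    in [computable_proj]. *)
Lemma wp_setup1 (R : realType) (n : nat) (t : nat) (s : state R) :
  reg s 0 = n ->
  wp setup1_prog (fun t' s' => [/\ (t' <= t + (n + 2))%N, reg s' 0 = n,
    same_below n (mem s) (mem s') &
    [/\ mem s' (2 * n + 2)%N = - mem s 0%N, mem s' (2 * n + 3)%N = 1 &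
      True]]) t s.
Proof.
move=> s0; rewrite /setup1_prog /= s0; split=> //; update_simp.
split=> //; first by lia.
  by move=> k kn /=; update_simp.
by split=> //=; update_simp; rewrite ?sub0r.
Qed.

Lemma wp_setupy (R : realType) (n : nat) (t : nat) (s : state R) :
  reg s 0 = n ->
  wp setupy_prog (fun t' s' => [/\ (t' <= t + (n + 2))%N, reg s' 0 = n,
    same_below n (mem s) (mem s') &
    [/\ mem s' (2 * n + 2)%N = - (- (Num.sqrt n%:R * mem s 0%N)),
      mem s' (2 * n + 3)%N = n%:R &
      mem s' (2 * n + 6)%N = Num.sqrt n%:R]]) t s.
Proof.
move=> s0; rewrite opprK.
pose I i m := [/\ same_below n (mem s) m, m (2 * n + 3)%N = i%:R &
  m (2 * n + 5)%N = 1].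
do 2!apply: wp_seq; do 2!apply: wp_load; apply: wp_seq.
apply: (wp_mono _ (@wp_for R _ n 1 I t _ _ _ _)) => [t1 s1|||].
- move=> [t1t h0 [hs h3 h5]]; rewrite /= h0 h3 ler0n; update_simp; split=> //.
  split=> //; split=> //; first by lia.
    by move=> k kn /=; update_simp; apply: hs.
  by split=> /=; update_simp; rewrite // hs.
- move=> i si ti ni r0 r1 [ms m3 m5]; split=> //=; rewrite r0 ?r1.
  split=> //; first by lia.
  split; [|by update_simp; rewrite m3 m5 natr1|by update_simp].
  by move=> k kn; update_simp; apply: ms.
- by rewrite /= s0.
- rewrite /= s0; split; [|by update_simp|by update_simp].
  by move=> k kn; update_simp.
Qed.

Lemma wp_output1 (R : realType) (n : nat) (t : nat) (s : state R) :
  reg s 0 = n -> let l := mem s (2 * n + 4)%N in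
  wp output1_prog (fun t' s' => [/\ (t' <= t + (n * 3 + 2))%N,
    mem s' 0%N = mem s 0%N + l
  & forall i, (i < n)%N -> mem s' i.+1 = soft l (mem s i.+1)]) t s.
Proof.
move=> s0 l; do 2!apply: wp_seq; apply: wp_load; apply: wp_arith => //.
apply: wp_seq; apply: wp_arith => //.
apply: (wp_mono _ (@wp_map R n 3 l (soft l) _ _ _ _ _ _ _)) => [t' s'||||].
- rewrite /= s0; update_simp => -[tt' -> m]; split=> //; first by lia.
  by move=> i ni; rewrite m //; update_simp.
- move=> i si ti ni r0 r1 m1 m4; exact: wp_soft m4.
- by [].
- by rewrite /= s0; update_simp; rewrite sub0r.
- by rewrite /= s0; update_simp.
Qed.

Lemma wp_outputy (R : realType) (n : nat) (t : nat) (s : state R) :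
  reg s 0 = n -> let l := mem s (2 * n + 4)%N in
  wp outputy_prog (fun t' s' => [/\ (t' <= t + (n * 3 + 2))%N,
    mem s' 0%N = mem s (2 * n + 6)%N * l
  & forall i, (i < n)%N -> mem s' i.+1 = clip l (mem s i.+1)]) t s.
Proof.
move=> s0 l; do 2!apply: wp_seq; apply: wp_load; apply: wp_arith => //.
apply: wp_seq; apply: wp_arith => //.
apply: (wp_mono _ (@wp_map R n 3 l (clip l) _ _ _ _ _ _ _)) => [t' s'||||].
- rewrite /= s0; update_simp => -[tt' -> m]; split=> //; first by lia.
  by move=> i ni; rewrite m //; update_simp.
- move=> i si ti ni r0 r1 m1 m4; exact: wp_clip m4.
- by [].
- by rewrite /= s0; update_simp; rewrite sub0r.
- by rewrite /= s0; update_simp.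
Qed.

(** Total of sorting [n (L + 2)], setup [n + 2], threshold [2 + 4 n] and output [3 n + 2], with
    [L = trunc_log 2 n + 1]. *)
Definition cost (n : nat) : nat := n * (trunc_log 2 n + 11) + 6.

Lemma cost_nlogn (R : realType) :
  (fun n : nat => (cost n)%:R : R^o) =O_\oo (fun n : nat => n%:R * ln n%:R : R^o).
Proof.
have ln2 : 0 < ln (2 : R) by rewrite ln_gt0 // ltr1n.
(* For [n >= 2] the logarithm [trunc_log 2 n] is at least 1, so the cost is at most
   [1 + 11 + 6 = 18] times [n * trunc_log 2 n]. *)
apply/eqO_exP; exists (18 / ln 2); first by rewrite divr_gt0.
near=> n.
have n2 : (2 <= n)%N by near: n; exact: nbhs_infty_ge.
have n0 : 0 < n%:R :> R by rewrite ltr0n; lia.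
have tl : (trunc_log 2 n)%:R * ln 2 <= ln n%:R :> R.
  rewrite mulr_natl -lnXn // ler_ln ?posrE ?exprn_gt0 //.
  by rewrite -natrX ler_nat trunc_logP //; lia.
have t1 : 1 <= (trunc_log 2 n)%:R :> R.
  by rewrite ler1n trunc_log_gt0 //.
have l0 : 0 <= ln n%:R :> R by apply: le_trans tl; rewrite mulr_ge0 // ltW.
rewrite ger0_norm // ger0_norm ?mulr_ge0 //.
have -> : 18 / ln 2 * (n%:R * ln n%:R) = n%:R * (18 * (ln n%:R / ln 2)) :> R.
  by ring.
have {}tl : (trunc_log 2 n)%:R <= ln n%:R / ln 2 :> R by rewrite ler_pdivlMr.
have /le_trans : (cost n)%:R <= n%:R * ((trunc_log 2 n)%:R * 18) :> R.
  rewrite -!natrM ler_nat /cost; move: t1; rewrite ler1n => t1; nia.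
by apply; rewrite ler_wpM2l //; lra.
Unshelve. all: by end_near. Qed.

Lemma init_memE (R : realType) (n : nat) (u : 'rV[R]_n.+1) (i : 'I_n.+1) :
  mem (init u) i = u 0 i.
Proof. by rewrite /= valK. Qed.

(** Here [b] and [d] are the coefficients of the multiplier equation, [o] gives coordinate 0 of the
    output and [g] the others. The last hypothesis accepts any balanced [l], so uniqueness of the
    multiplier never has to be shown. *)
Lemma computable_proj (R : realType) (setup out : prog)
    (f : forall n, 'rV[R]_n.+1 -> 'rV[R]_n.+1) (b : nat -> R -> R)
    (d : nat -> R) (K : nat -> R -> Prop) (o : nat -> R -> R -> R)
    (g : R -> R -> R) :
  (forall n, (0 < n)%N -> 0 < d n) ->
  (forall n t s, reg s 0 = n -> wp setup (fun t' s' =>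
    [/\ (t' <= t + (n + 2))%N, reg s' 0 = n, same_below n (mem s) (mem s') &
    [/\ mem s' (2 * n + 2)%N = - b n (mem s 0%N),
      mem s' (2 * n + 3)%N = d n &
      K n (mem s' (2 * n + 6)%N)]]) t s) ->
  (forall n t s, reg s 0 = n -> K n (mem s (2 * n + 6)%N) ->
    let l := mem s (2 * n + 4)%N in
    wp out (fun t' s' => [/\ (t' <= t + (n * 3 + 2))%N,
      mem s' 0%N = o n (mem s 0%N) l
    & forall i, (i < n)%N -> mem s' i.+1 = g l (mem s i.+1)]) t s) ->
  (forall n (u : 'rV[R]_n.+1) l, (0 < n)%N ->
    balanced [seq `|u 0 (lift ord0 i)| | i <- enum 'I_n]
      (b n (u 0 0)) (d n) l ->
    f n u = cons_row (o n (u 0 0) l) (fun i => g l (u 0 (lift ord0 i)))) ->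
  computable_in_nlogn f.
Proof.
move=> d0 hsetup hout hf.
exists (Seq (Seq sort_prog (Seq setup threshold_prog)) out), cost.
split=> [|n n0 u]; first exact: cost_nlogn.
pose U := mem (init u); pose L := (trunc_log 2 n).+1.
have nL : (n <= 2 ^ L)%N by rewrite ltnW // trunc_log_ltn.
have U0 : U 0%N = u 0 0 := init_memE u 0.
have US (i : 'I_n) : U i.+1 = u 0 (lift ord0 i) := init_memE u (lift ord0 i).
have USE : [seq `|U k.+1| | k <- iota 0 n] =
    [seq `|u 0 (lift ord0 i)| | i <- enum 'I_n].
  by rewrite -val_enum_ord -map_comp; apply: eq_map => i /=; rewrite US.
suff /wp_exec[t [s [ex [tn sE]]]] :
    wp (Seq (Seq sort_prog (Seq setup threshold_prog)) out)
      (fun t' s' => (t' <= cost n)%N /\ output n s' = f n u) 0 (init u).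
  by exists t, s; split.
apply: wp_seq; apply: (wp_mono _ (@wp_balance R n L (n + 2) U (b n (U 0%N))
  (d n) (K n) setup 0 (init u) nL (d0 _ n0) _ _ _)) => //; last first.
  by move=> t s s0 <-; apply: hsetup.
move=> t1 s1 [t1t h0 mU bal hK].
apply: wp_mono (hout n t1 s1 h0 hK) => t2 s2 [t21 m0 mS]; split.
  by rewrite /cost /L in t1t *; lia.
move: bal; rewrite USE U0 => bal; rewrite (hf n u _ n0 bal).
apply/rowP => i; rewrite mxE; case: (unliftP ord0 i) => [j ->|->].
  by rewrite cons_rowS lift0 mS ?ltn_ord // (mU j.+1) ?ltn_ord ?US.
by rewrite cons_row0 /= m0 mU // U0.
Qed.

Theorem proposition4p4 (R : realType) (p : \bar R)
    (hp : p = 1%:E \/ p = +oo%E) :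
  computable_in_nlogn (fun (n : nat) (u : 'rV[R]_n.+1) =>
    let X : set 'rV[R]_n := lpball p n in
    let kappa : R := maximum [set lpnorm 2%:E x | x in X] in
    let C : set 'rV[R]_n.+1 := cone (lift_at kappa X) in
    proj C u).
Proof.
case: hp => ->.
- apply: (@computable_proj R setup1_prog output1_prog _ (fun _ x => x)
    (fun _ => 1) (fun _ _ => True) (fun _ x l => x + l) (@soft R)) => //.
  + by move=> n t s; apply: wp_setup1.
  + by move=> n t s s0 _; apply: wp_output1.
  + by move=> n u l n0 bal; rewrite /= maximum_lpball1 //; apply: proj_cone1.
- apply: (@computable_proj R setupy_prog outputy_prog _
    (fun n x => - (Num.sqrt n%:R * x)) (fun n => n%:R)
    (fun n k => k = Num.sqrt n%:R) (fun n _ l => Num.sqrt n%:R * l)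
    (@clip R)) => //.
  + by move=> n n0; rewrite ltr0n.
  + by move=> n t s; apply: wp_setupy.
  + by move=> n t s s0 k /=; rewrite -k; apply: wp_outputy.
  + by move=> n u l n0 bal; rewrite /= maximum_lpbally; apply: proj_coney.
Qed.
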